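(* Let $\alpha\in\mathbb{Q}$. The following holds: (i) If $\alpha<0$, then for every prime number $\ell$ the Ruban continued fraction expansion of $\alpha$ in $\mathbb{Q}_\ell$ does not terminate. (ii) If $\alpha\ge 0$ and $\alpha\in\mathbb{Z}$, then there are only finitely many prime numbers $\ell$ such that the Ruban continued fraction expansion of $\alpha$ in $\mathbb{Q}_\ell$ does not terminate. (iii) If $\alpha\ge 0$ and $\alpha\notin\mathbb{Z}$, then there are only finitely many prime numbers $\ell$ such that the Ruban continued fraction expansion of $\alpha$ in $\mathbb{Q}_\ell$ terminates.
   Context: For a prime $\ell$ and $\alpha\in\mathbb{Q}_\ell$, the $\ell$-adic integral part $\lfloor\alpha\rfloor_\ell$ is the unique $a\in\mathbb{Z}[1/\ell]$ with $0\le a<\ell$ and $|\alpha-a|_\ell<1$, where $|\cdot|_\ell$ is the $\ell$-adic absolute value. The Ruban continued fraction expansion of $\alpha$ in $\mathbb{Q}_\ell$ is defined by $\alpha_0:=\alpha$, $a_n:=\lfloor\alpha_n\rfloor_\ell$, $r_n:=\alpha_n-a_n$, and $\alpha_{n+1}:=1/r_n$ whenever $r_n\neq 0$; if $r_n=0$ for some $n$ the procedure stops and the expansion is said to terminate. A rational number is viewed as an element of $\mathbb{Q}_\ell$ for each prime $\ell$. *)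

(* Defs.v *)
From HB Require Import structures.
From mathcomp Require Import all_boot all_order all_algebra.
From mathcomp Require Import boolp classical_sets functions cardinality.
From mathcomp Require Import zify lra ring.

Set Implicit Arguments.
Unset Strict Implicit.
Unset Printing Implicit Defensive.
Import Order.TTheory GRing.Theory Num.Theory.
Local Open Scope ring_scope.

Definition padic_val (l : nat) (q : rat) : int :=
  (logn l `|numq q|)%:Z - (logn l `|denq q|)%:Z.

(* When l is not prime, [logn l] is 0 and this is the trivial absolute value;
   hence the constructions below make sense for every l, but are only
   meaningful for l prime. *)
Definition padic_abs (l : nat) (q : rat) : rat :=
  if q == 0 then 0 else l%:R ^ (- padic_val l q).

Section PadicAbs.
Variable l : nat.
Local Notation pabs := (padic_abs l).

Lemma padic_abs0 : pabs 0 = 0.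
Proof. by rewrite /padic_abs eqxx. Qed.

Lemma padic_abs_nprime q : ~~ prime l -> pabs q = (q != 0)%:R.
Proof.
move=> /negPf lnp; rewrite /padic_abs /padic_val.
have l0 m : logn l m = 0%N by rewrite lognE lnp.
by case: eqP => //= _; rewrite !l0 subrr oppr0 expr0z.
Qed.

Lemma padic_abs_gt0 q : q != 0 -> 0 < pabs q.
Proof.
have [lp|lnp] := boolP (prime l); last by move=> q0; rewrite padic_abs_nprime ?q0.
by rewrite /padic_abs => /negPf ->; rewrite exprz_gt0// ltr0n prime_gt0.
Qed.

Lemma padic_abs_ge0 q : 0 <= pabs q.
Proof. by have [->|/padic_abs_gt0/ltW//] := eqVneq q 0; rewrite padic_abs0. Qed.

Lemma padic_abs_eq0 q : (pabs q == 0) = (q == 0).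
Proof.
by have [->|/padic_abs_gt0] := eqVneq q 0; rewrite ?padic_abs0 ?eqxx// => /gt_eqF.
Qed.

Lemma padic_abs_frac (a b : int) : prime l -> a != 0 -> b != 0 ->
  pabs (a%:~R / b%:~R) = l%:R ^ ((logn l `|b|)%:Z - (logn l `|a|)%:Z).
Proof.
move=> lp a0 b0; set q : rat := a%:~R / b%:~R.
have q0 : q != 0 by rewrite mulf_neq0 ?invr_eq0 ?intr_eq0.
rewrite /padic_abs (negPf q0) /padic_val; congr (_ ^ _).
have e : numq q * b = a * denq q.
  apply: (@intr_inj rat); rewrite !intrM numqE -mulrA [_%:~R * b%:~R]mulrC mulrA.
  by rewrite /q divfK ?intr_eq0.
have := congr1 (fun z : int => logn l `|z|%N) e; rewrite /= !abszM !lognM;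
  rewrite ?absz_gt0 ?numq_eq0 ?denq_neq0//; lia.
Qed.

Lemma padic_abs_int (a : int) : prime l -> a != 0 ->
  pabs a%:~R = l%:R ^ (- (logn l `|a|)%:Z).
Proof.
move=> lp a0; have := @padic_abs_frac a 1 lp a0 isT.
by rewrite divr1 logn1 add0r.
Qed.

Lemma padic_abs1 : pabs 1 = 1.
Proof. by rewrite /padic_abs oner_eq0 /padic_val logn1 subrr oppr0 expr0z. Qed.

Lemma padic_absM x y : pabs (x * y) = pabs x * pabs y.
Proof.
have [lp|lnp] := boolP (prime l); last first.
  by rewrite !padic_abs_nprime// mulf_eq0 negb_or; do 2!case: (_ == _).
have [->|x0] := eqVneq x 0; first by rewrite mul0r padic_abs0 mul0r.
have [->|y0] := eqVneq y 0; first by rewrite mulr0 padic_abs0 mulr0.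
have l0 : l%:R != 0 :> rat by rewrite pnatr_eq0 -lt0n prime_gt0.
rewrite -[x]divq_num_den -[y]divq_num_den mulf_div -!intrM.
rewrite !padic_abs_frac ?mulf_neq0 ?denq_neq0 ?numq_eq0// -expfzDr//.
rewrite !abszM !lognM ?absz_gt0 ?denq_neq0 ?numq_eq0//; congr (_ ^ _); lia.
Qed.

Lemma padic_absN x : pabs (- x) = pabs x.
Proof. by rewrite /padic_abs oppr_eq0 /padic_val numqN denqN abszN. Qed.

Lemma padic_absV x : pabs x^-1 = (pabs x)^-1.
Proof.
have [->|x0] := eqVneq x 0; first by rewrite !(invr0, padic_abs0).
have p0 : pabs x != 0 by rewrite padic_abs_eq0.
by apply: (mulfI p0); rewrite -padic_absM !mulfV// padic_abs1.
Qed.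

Lemma padic_abs_intD (a b : int) : pabs (a + b)%:~R <= Num.max (pabs a%:~R) (pabs b%:~R).
Proof.
have [lp|lnp] := boolP (prime l); last first.
  rewrite !padic_abs_nprime// !intr_eq0 le_max.
  have [->|a0] := eqVneq a 0; first by rewrite add0r lexx orbT.
  by case: (a + b == 0).
have [->|a0] := eqVneq a 0; first by rewrite add0r le_max lexx orbT.
have [->|b0] := eqVneq b 0; first by rewrite addr0 le_max lexx.
have [->|ab0] := eqVneq (a + b) 0; first by rewrite le_max padic_abs0 padic_abs_ge0.
have l1 : 1 < l%:R :> rat by rewrite ltr1n prime_gt1.
rewrite !padic_abs_int// le_max !ler_eXz2l// !lerN2 !lez_nat.
have key (k : nat) : (k <= logn l `|a|)%N -> (k <= logn l `|b|)%N ->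
    (k <= logn l `|(a + b)%R|)%N.
  rewrite -!(@pfactor_dvdn l) ?absz_gt0//.
  move=> ha hb; suff : a + b \in dvdz (l ^ k)%N by [].
  by apply: rpredD.
have [h|/ltnW h] := leqP (logn l `|a|) (logn l `|b|).
  by rewrite key.
by rewrite orbC key.
Qed.

Lemma padic_absD x y : pabs (x + y) <= Num.max (pabs x) (pabs y).
Proof.
have d0 : (denq x * denq y)%:~R != 0 :> rat by rewrite intr_eq0 mulf_neq0 ?denq_neq0.
have ex : x = (numq x * denq y)%:~R / (denq x * denq y)%:~R.
  by rewrite !intrM -mulf_div divq_num_den divff ?mulr1// intr_eq0 denq_neq0.
have ey : y = (denq x * numq y)%:~R / (denq x * denq y)%:~R.
  by rewrite !intrM -mulf_div divq_num_den divff ?mul1r// intr_eq0 denq_neq0.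
move: (numq x * denq y) (denq x * numq y) (denq x * denq y) d0 ex ey.
move=> a b d d0 -> ->; rewrite -mulrDl -intrD !padic_absM.
rewrite -maxr_pMl ?padic_abs_ge0// ler_wpM2r ?padic_abs_ge0//.
exact: padic_abs_intD.
Qed.

Lemma padic_absD_lt e x y : pabs x < e -> pabs y < e -> pabs (x + y) < e.
Proof. by move=> hx hy; apply: le_lt_trans (padic_absD _ _) _; rewrite gt_max hx. Qed.

End PadicAbs.

Definition padic_cauchy (l : nat) (u : nat -> rat) : Prop :=
  forall e : rat, 0 < e -> exists N, forall m n, (N <= m)%N -> (N <= n)%N ->
    padic_abs l (u m - u n) < e.

Definition padic_null (l : nat) (u : nat -> rat) : Prop :=
  forall e : rat, 0 < e -> exists N, forall n, (N <= n)%N -> padic_abs l (u n) < e.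

Definition cauchy_pred (l : nat) : {pred (nat -> rat)} :=
  fun u => `[< padic_cauchy l u >].

Lemma padic_cauchy_bounded l u : padic_cauchy l u ->
  exists2 B, 0 < B & exists N, forall n, (N <= n)%N -> padic_abs l (u n) < B.
Proof.
move=> /(_ 1 ltr01)[N hN]; exists (1 + padic_abs l (u N)).
  by rewrite ltr_pwDl ?padic_abs_ge0.
exists N => n Nn; rewrite -(subrK (u N) (u n)).
have a0 := padic_abs_ge0 l (u N).
by apply: padic_absD_lt; [have := hN n N Nn (leqnn _)|]; lra.
Qed.

Lemma seqB (u v : nat -> rat) n : (u - v) n = u n - v n. Proof. by []. Qed.

Lemma seqM (u v : nat -> rat) n : (u * v) n = u n * v n. Proof. by []. Qed.

Lemma cauchy_subring_closed l : subring_closed (cauchy_pred l).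
Proof.
split=> [|u v /asboolP hu /asboolP hv|u v /asboolP hu /asboolP hv]; apply/asboolP => e e0.
- by exists 0%N => m n _ _; rewrite [X in padic_abs _ X]subrr padic_abs0.
- have [N hN] := hu e e0; have [M hM] := hv e e0.
  exists (maxn N M) => m n; rewrite !geq_max => /andP[Nm Mm] /andP[Nn Mn].
  have -> : (u - v) m - (u - v) n = (u m - u n) + - (v m - v n).
    rewrite !seqB !opprB -!addrA; congr (_ + _).
    by rewrite addrCA [RHS]addrCA [- u n - v m]addrC.
  by apply: padic_absD_lt; rewrite ?padic_absN; [exact: hN|exact: hM].
- have [B B0 [N0 hB]] := padic_cauchy_bounded hu.
  have [C C0 [M0 hC]] := padic_cauchy_bounded hv.
  have [N hN] := hu (e / C) (divr_gt0 e0 C0).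
  have [M hM] := hv (e / B) (divr_gt0 e0 B0).
  exists (maxn (maxn N M) (maxn N0 M0)) => m n.
  rewrite !geq_max => /andP[/andP[Nm Mm] /andP[N0m M0m]] /andP[/andP[Nn Mn] /andP[N0n M0n]].
  have -> : (u * v) m - (u * v) n = u m * (v m - v n) + (u m - u n) * v n.
    by rewrite !seqM mulrBr mulrBl addrA subrK.
  apply: padic_absD_lt; rewrite padic_absM.
    rewrite -(divfK (lt0r_neq0 B0) e) mulrC.
    by apply: ltr_pM; rewrite ?padic_abs_ge0// ?hB ?hM.
  rewrite -(divfK (lt0r_neq0 C0) e).
  by apply: ltr_pM; rewrite ?padic_abs_ge0// ?hC ?hN.
Qed.

HB.instance Definition _ (l : nat) :=
  GRing.isSubringClosed.Build (nat -> rat) (cauchy_pred l) (@cauchy_subring_closed l).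

Record cauchy_seq (l : nat) := CauchySeq {
  cauchy_val :> nat -> rat;
  cauchy_valP : cauchy_val \in cauchy_pred l }.

HB.instance Definition _ l := [isSub for @cauchy_val l].
HB.instance Definition _ l := [Choice of cauchy_seq l by <:].
HB.instance Definition _ l := [SubChoice_isSubComNzRing of cauchy_seq l by <:].

Definition null_pred (l : nat) : {pred (cauchy_seq l)} :=
  fun u => `[< padic_null l u >].

Lemma null_idealr_closed l : idealr_closed (null_pred (l := l)).
Proof.
split=> [||u v w /asboolP hv /asboolP hw].
- by apply/asboolP => e e0; exists 0%N => n _; rewrite [X in padic_abs _ X]/(0) padic_abs0.
- apply/asboolP => /(_ 1 ltr01)[N /(_ N (leqnn _))].
  by rewrite [X in padic_abs _ X]/(1) padic_abs1 ltxx.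
- apply/asboolP => e e0.
  have [B B0 [N0 hB]] := padic_cauchy_bounded (asboolP _ (cauchy_valP u)).
  have [N hN] := hv (e / B) (divr_gt0 e0 B0); have [M hM] := hw e e0.
  exists (maxn (maxn N M) N0) => n; rewrite !geq_max => /andP[/andP[Nn Mn] N0n].
  rewrite [X in padic_abs _ X]/(u n * v n + w n).
  apply: padic_absD_lt; last exact: hM.
  rewrite padic_absM -(divfK (lt0r_neq0 B0) e) mulrC.
  by apply: ltr_pM; rewrite ?padic_abs_ge0// ?hB ?hN.
Qed.

HB.instance Definition _ (l : nat) :=
  isIdealr.Build (cauchy_seq l) (@null_pred l) (@null_idealr_closed l).

(* Q_l, for l prime: the completion of rat, as Cauchy sequences for padic_abs l
   modulo null sequences. The embedding of rat is [ratr]. *)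
Definition padic (l : nat) : Type := {ideal_quot @null_pred l}.

HB.instance Definition _ l := GRing.ComNzRing.on (padic l).

Definition padic_class (l : nat) (u : cauchy_seq l) : padic l :=
  \pi_({ideal_quot @null_pred l})%qT u.

Lemma padic_class_is_zmod_morphism l : zmod_morphism (@padic_class l).
Proof. by move=> u v; rewrite /padic_class rmorphB. Qed.

Lemma padic_class_is_monoid_morphism l : monoid_morphism (@padic_class l).
Proof. by split=> [|u v]; rewrite /padic_class (rmorph1, rmorphM). Qed.

HB.instance Definition _ l := GRing.isZmodMorphism.Build (cauchy_seq l) (padic l)
  (@padic_class l) (@padic_class_is_zmod_morphism l).
HB.instance Definition _ l := GRing.isMonoidMorphism.Build (cauchy_seq l) (padic l)
  (@padic_class l) (@padic_class_is_monoid_morphism l).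

Lemma padic_classP l (u v : cauchy_seq l) :
  padic_class u = padic_class v <-> padic_null l (u - v).
Proof.
split=> [/eqP|h]; first by rewrite /padic_class -Quotient.idealrBE => /asboolP.
by apply/eqP; rewrite /padic_class -Quotient.idealrBE; apply/asboolP.
Qed.

Lemma padic_class_ind l (P : padic l -> Prop) :
  (forall u, P (padic_class u)) -> forall x, P x.
Proof.
move=> h x; have -> : x = padic_class (repr x : cauchy_seq l); last exact: h.
by rewrite /padic_class reprK.
Qed.

Lemma padic_abs_eq l x y : padic_abs l (x - y) < padic_abs l y ->
  padic_abs l x = padic_abs l y.
Proof.
move=> h; apply/eqP; rewrite eq_le; apply/andP; split.
  by rewrite -{1}(subrK y x) (le_trans (padic_absD _ _ _))// ge_max lexx ltW.
rewrite leNgt; apply/negP => h'.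
suff : padic_abs l y < padic_abs l y by rewrite ltxx.
rewrite -{1}(subKr x y); apply: padic_absD_lt => //.
by rewrite padic_absN.
Qed.

Lemma padic_null_dichotomy l (u : nat -> rat) : padic_cauchy l u ->
  padic_null l u \/
  (exists2 c, 0 < c & exists N, forall n, (N <= n)%N -> padic_abs l (u n) = c).
Proof.
move=> hu; have [|/existsNP[e /not_implyP[e0 he]]] := pselect (padic_null l u).
  by left.
right; have [N hN] := hu e e0.
have [n0 Nn0 hn0] : exists2 n0, (N <= n0)%N & e <= padic_abs l (u n0).
  apply: contrapT => h; apply: he; exists N => n Nn; rewrite ltNge.
  by apply/negP => he; apply: h; exists n.
exists (padic_abs l (u n0)); first exact: lt_le_trans e0 hn0.
exists N => n Nn; apply: padic_abs_eq.
exact: lt_le_trans (hN _ _ Nn Nn0) hn0.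
Qed.

Lemma padic_cauchyV l u : padic_cauchy l u -> ~ padic_null l u ->
  padic_cauchy l (fun n => (u n)^-1).
Proof.
move=> hu nu; have [//|[c c0 [N0 hc]]] := padic_null_dichotomy hu.
move=> e e0; have [N hN] := hu (e * c * c) (mulr_gt0 (mulr_gt0 e0 c0) c0).
exists (maxn N N0) => m n; rewrite !geq_max => /andP[Nm N0m] /andP[Nn N0n].
have um0 : u m != 0 by rewrite -(padic_abs_eq0 l) hc// gt_eqF.
have un0 : u n != 0 by rewrite -(padic_abs_eq0 l) hc// gt_eqF.
have -> : (u m)^-1 - (u n)^-1 = (u n - u m) / (u m * u n) by field; apply/andP.
rewrite padic_absM padic_absV padic_absM !hc// ltr_pdivrMr ?mulr_gt0//.
by rewrite mulrA hN.
Qed.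

Lemma padic_inv_ex l (x : padic l) : x != 0 -> exists y, y * x = 1.
Proof.
elim/padic_class_ind: x => u u0.
have hu : padic_cauchy l u by exact/asboolP/cauchy_valP.
have nu : ~ padic_null l u.
  move=> h; case/eqP: u0; rewrite -(raddf0 (@padic_class l)).
  by apply/padic_classP; rewrite subr0.
have vP : (fun n => (u n)^-1) \in cauchy_pred l by apply/asboolP/padic_cauchyV.
exists (padic_class (CauchySeq vP)).
rewrite -rmorphM -(rmorph1 (@padic_class l)); apply/padic_classP => e e0.
have [//|[c c0 [N hc]]] := padic_null_dichotomy hu.
exists N => n Nn; rewrite [X in padic_abs _ X]/((u n)^-1 * u n - 1).
have un0 : u n != 0 by rewrite -(padic_abs_eq0 l) hc// gt_eqF.
by rewrite mulVf// subrr padic_abs0.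
Qed.

Definition padic_inv l (x : padic l) : padic l :=
  if x == 0 then 0 else xget 0 [set y | y * x = 1]%classic.

Lemma padic_mulVf l (x : padic l) : x != 0 -> padic_inv x * x = 1.
Proof.
move=> x0; rewrite /padic_inv (negPf x0).
exact: (xgetPex 0 (padic_inv_ex x0)).
Qed.

Lemma padic_inv0 l : padic_inv (0 : padic l) = 0.
Proof. by rewrite /padic_inv eqxx. Qed.

HB.instance Definition _ l := GRing.ComNzRing_isField.Build (padic l)
  (@padic_mulVf l) (@padic_inv0 l).

Lemma cauchy_constP l (q : rat) : (fun=> q) \in cauchy_pred l.
Proof. by apply/asboolP => e e0; exists 0%N => m n _ _; rewrite subrr padic_abs0. Qed.

Definition cauchy_const l (q : rat) : cauchy_seq l := CauchySeq (cauchy_constP l q).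

Definition padic_of_rat l (q : rat) : padic l := padic_class (cauchy_const l q).

Lemma padic_of_rat_is_zmod_morphism l : zmod_morphism (@padic_of_rat l).
Proof. by move=> p q; rewrite /padic_of_rat -rmorphB; congr padic_class; exact/val_inj. Qed.

Lemma padic_of_rat_is_monoid_morphism l : monoid_morphism (@padic_of_rat l).
Proof.
split=> [|p q]; rewrite /padic_of_rat.
  by rewrite -[RHS](rmorph1 (@padic_class l)); congr padic_class; exact/val_inj.
by rewrite -rmorphM; congr padic_class; exact/val_inj.
Qed.

HB.instance Definition _ l := GRing.isZmodMorphism.Build rat (padic l)
  (@padic_of_rat l) (@padic_of_rat_is_zmod_morphism l).
HB.instance Definition _ l := GRing.isMonoidMorphism.Build rat (padic l)
  (@padic_of_rat l) (@padic_of_rat_is_monoid_morphism l).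

Lemma padic_ratrE l (q : rat) : ratr q = padic_of_rat l q.
Proof. by rewrite -(fmorph_eq_rat (@padic_of_rat l)). Qed.

Lemma padic_ratrB l (p q : rat) : ratr (p - q) = ratr p - ratr q :> padic l.
Proof. by rewrite !padic_ratrE; exact: rmorphB (@padic_of_rat l) p q. Qed.

Definition rat_seq_lim (u : nat -> rat) (c : rat) : Prop :=
  forall e : rat, 0 < e -> exists N, forall n, (N <= n)%N -> `|u n - c| < e.

(* The absolute value on Q_l: the limit of |u_n|_l along any sequence u of
   rationals representing x (see padicnorm_class). *)
Definition padicnorm (l : nat) (x : padic l) : rat :=
  xget 0 [set c | rat_seq_lim (padic_abs l \o (repr x : cauchy_seq l)) c]%classic.

Lemma padic_abs_dist l x y :
  `|padic_abs l x - padic_abs l y| <= padic_abs l (x - y).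
Proof.
have tri a b : padic_abs l (a + b) <= padic_abs l a + padic_abs l b.
  rewrite (le_trans (padic_absD _ _ _))// ge_max lerDl lerDr.
  by rewrite !padic_abs_ge0.
rewrite ler_norml; have := tri (x - y) y; have := tri (y - x) x.
rewrite !subrK -opprB padic_absN; lra.
Qed.

Lemma rat_seq_lim_unique u c d : rat_seq_lim u c -> rat_seq_lim u d -> c = d.
Proof.
move=> hc hd; apply/eqP; rewrite -subr_eq0 -normr_le0 leNgt; apply/negP => h.
have h2 : 0 < `|c - d| / 2 by rewrite divr_gt0.
have [N hN] := hc _ h2; have [M hM] := hd _ h2.
have := hN _ (leq_maxl N M); have := hM _ (leq_maxr N M).
move: (u _) => x; have := ler_normB (x - d) (x - c).
have -> : x - d - (x - c) = c - d by ring.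
lra.
Qed.

Lemma padicnorm_class l (u : cauchy_seq l) c :
  rat_seq_lim (padic_abs l \o u) c <-> padicnorm (padic_class u) = c.
Proof.
rewrite /padicnorm; set v := (repr (padic_class u) : cauchy_seq l).
have nuv : padic_null l (v - u).
  by apply/padic_classP; rewrite /v /padic_class reprK.
have huv d : rat_seq_lim (padic_abs l \o v) d -> rat_seq_lim (padic_abs l \o u) d.
  move=> h e e0; have e2 : 0 < e / 2 by rewrite divr_gt0.
  have [N hN] := h _ e2; have [M hM] := nuv _ e2.
  exists (maxn N M) => n; rewrite geq_max => /andP[/hN h1 /hM].
  rewrite [X in padic_abs _ X]/(v n - u n) => h2.
  have := padic_abs_dist l (v n) (u n); move: h1 => /=.
  have := ler_normB (padic_abs l (v n) - d) (padic_abs l (v n) - padic_abs l (u n)).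
  have -> : padic_abs l (v n) - d - (padic_abs l (v n) - padic_abs l (u n))
    = padic_abs l (u n) - d by ring.
  lra.
have [d hd] : exists d, rat_seq_lim (padic_abs l \o v) d.
  have [|hv|[d _ [N hN]]] := @padic_null_dichotomy l v.
  - exact/asboolP/cauchy_valP.
  - exists 0 => e /hv[N hN]; exists N => n /hN /=.
    by rewrite subr0 ger0_norm ?padic_abs_ge0.
  - by exists d => e e0; exists N => n /hN /= ->; rewrite subrr normr0.
rewrite (@xget_unique _ 0 _ d)//; last first.
  by move=> d' hd'; exact: rat_seq_lim_unique hd' hd.
split=> [hc|<-]; first exact: rat_seq_lim_unique (huv _ hd) hc.
exact: huv.
Qed.

Lemma padicnorm_ratr l (q : rat) : padicnorm (ratr q : padic l) = padic_abs l q.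
Proof.
rewrite padic_ratrE /padic_of_rat; apply/padicnorm_class => e e0.
by exists 0%N => n _; rewrite /= subrr normr0.
Qed.

Lemma padicnormD l (x y : padic l) :
  padicnorm (x + y) <= Num.max (padicnorm x) (padicnorm y).
Proof.
elim/padic_class_ind: x => u; elim/padic_class_ind: y => v; rewrite -rmorphD.
have /padicnorm_class := erefl (padicnorm (padic_class u)).
have /padicnorm_class := erefl (padicnorm (padic_class v)).
have /padicnorm_class := erefl (padicnorm (padic_class (u + v))).
move: (padicnorm _) (padicnorm _) (padicnorm _) => c d f hf hd hc.
rewrite leNgt; apply/negP => h.
have : c <= Num.max c d by rewrite le_max lexx.
have : d <= Num.max c d by rewrite le_max lexx orbT.
move: (Num.max c d) h => M h dM cM.
have e0 : 0 < (f - M) / 2 by rewrite divr_gt0// subr_gt0.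
have [N1 h1] := hf _ e0; have [N2 h2] := hd _ e0; have [N3 h3] := hc _ e0.
pose n := maxn N1 (maxn N2 N3).
have := h1 n (leq_maxl _ _); have := h2 n (leq_trans (leq_maxl _ _) (leq_maxr _ _)).
have := h3 n (leq_trans (leq_maxr _ _) (leq_maxr _ _)) => /=.
have := padic_absD l (u n) (v n); rewrite -[u n + v n]/((u + v) n).
move: (padic_abs _ _) (padic_abs _ _) (padic_abs _ _) => A B C.
by rewrite !ltr_norml le_max => /orP[] ? /andP[? ?] /andP[? ?] /andP[? ?]; lra.
Qed.

Lemma padicnormN l (x : padic l) : padicnorm (- x) = padicnorm x.
Proof.
elim/padic_class_ind: x => u; rewrite -rmorphN; apply/padicnorm_class => e e0.
have /padicnorm_class/(_ e e0)[N hN] := erefl (padicnorm (padic_class u)).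
by exists N => n /hN /=; rewrite padic_absN.
Qed.

Lemma padic_dense l (x : padic l) (e : rat) : 0 < e ->
  exists q : rat, padicnorm (x - ratr q) < e.
Proof.
elim/padic_class_ind: x => u e0; have e2 : 0 < e / 2 by rewrite divr_gt0.
have hu : padic_cauchy l u by exact/asboolP/cauchy_valP.
have [N hN] := hu _ e2; exists (u N).
rewrite padic_ratrE /padic_of_rat -rmorphB.
have /padicnorm_class/(_ _ e2)[M hM] :=
  erefl (padicnorm (padic_class (u - cauchy_const l (u N)))).
have := hM _ (leq_maxl M N) => /=.
rewrite [X in padic_abs _ X]/(u (maxn M N) - u N).
have := hN _ N (leq_maxr M N) (leqnn _).
by rewrite ltr_norml; lra.
Qed.

(* a belongs to Z[1/l]. *)
Definition in_Zinv (l : nat) (a : rat) : Prop :=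
  exists (m : int) (k : nat), a = m%:~R / l%:R ^+ k.

Definition is_padic_floor (l : nat) (x : padic l) (a : rat) : Prop :=
  [/\ in_Zinv l a, 0 <= a, a < l%:R & padicnorm (x - ratr a) < 1].

(* By padic_floor_exists and padic_floor_unique, for l prime the default
   value 0 is never used and the chosen element is the only candidate. *)
Definition padic_floor (l : nat) (x : padic l) : rat :=
  xget 0 [set a | is_padic_floor x a]%classic.

Lemma padic_floor_rat l (q : rat) : prime l ->
  exists a, [/\ in_Zinv l a, 0 <= a, a < l%:R & padic_abs l (q - a) < 1].
Proof.
move=> lp; have l0 : (0 < l)%N := prime_gt0 lp.
have lR : l%:R != 0 :> rat by rewrite pnatr_eq0 -lt0n.
have d0 : (0 < `|denq q|)%N by rewrite absz_gt0 denq_neq0.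
have [d ld ed] := pfactor_coprime lp d0.
set k := logn l `|denq q| in ed.
have dpos : (0 < d)%N by case: d ed d0 {ld} => // -> .
have dR : d%:R != 0 :> rat by rewrite pnatr_eq0 -lt0n.
pose L : int := (l ^ k.+1)%N.
have L0 : L != 0 by rewrite /L eqz_nat -lt0n expn_gt0 l0.
have cop : coprimez d L by rewrite coprimezE /= coprime_sym coprimeXl.
have [[u v] /= uv] := coprimezP _ _ cop.
pose t := ((numq q * u) %% L)%Z.
have t0 : 0 <= t by rewrite modz_ge0.
have tL : t < L by rewrite ltz_pmod// lt0r L0.
have hdiv : (L %| numq q - t * d)%Z.
  have e : numq q = numq q * v * L + numq q * u * d.
    by rewrite -[LHS]mulr1 -uv mulrDr addrC !mulrA.
  by rewrite -eqz_mod_dvd eq_sym /t modzMml {2}e modzMDl.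
exists (t%:~R / l%:R ^+ k).
have lk0 : 0 < l%:R ^+ k :> rat by rewrite exprn_gt0// ltr0n.
split.
- by exists t, k.
- by rewrite divr_ge0 ?ler0z ?(ltW lk0).
- by rewrite ltr_pdivrMr// -exprS -natrX -[X in _ < X]/(L%:~R) ltr_int.
have -> : q - t%:~R / l%:R ^+ k = (numq q - t * d)%:~R / (d * l ^ k)%N%:~R.
  rewrite -{1}(divq_num_den q).
  have -> : denq q = (d * l ^ k)%N by rewrite -ed absz_denq.
  rewrite intrB intrM -!pmulrn natrM natrX.
  by field; rewrite dR expf_neq0.
have [->|s0] := eqVneq (numq q - t * d) 0; first by rewrite mul0r padic_abs0.
rewrite padic_abs_frac// ?eqz_nat -?lt0n ?muln_gt0 ?dpos ?expn_gt0 ?l0//.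
rewrite /= -ed -/k -(expr0z l%:R) ltr_eXz2l ?ltr1n ?prime_gt1//.
have : (k.+1 <= logn l `|(numq q - t * d)%R|)%N.
  by rewrite -pfactor_dvdn ?absz_gt0.
lia.
Qed.

Lemma padic_floor_exists l (x : padic l) : prime l -> exists a, is_padic_floor x a.
Proof.
move=> lp; have [q hq] := padic_dense x ltr01.
have [a [a1 a2 a3 a4]] := padic_floor_rat q lp; exists a; split=> //.
have -> : x - ratr a = (x - ratr q) + (ratr q - ratr a) by rewrite addrA subrK.
apply: le_lt_trans (padicnormD _ _) _.
by rewrite gt_max hq -padic_ratrB padicnorm_ratr.
Qed.

Lemma padic_floor_unique l (x : padic l) a b : prime l ->
  is_padic_floor x a -> is_padic_floor x b -> a = b.
Proof.
move=> lp [[m [j ea]] a0 al ha] [[n [k eb]] b0 bl hb].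
have l0 : (0 < l)%N := prime_gt0 lp.
have lR : l%:R != 0 :> rat by rewrite pnatr_eq0 -lt0n.
have hab : padic_abs l (a - b) < 1.
  rewrite -padicnorm_ratr padic_ratrB.
  have -> : ratr a - ratr b = (x - ratr b) + - (x - ratr a) :> padic l.
    by rewrite opprB [RHS]addrC addrA subrK.
  by apply: le_lt_trans (padicnormD _ _) _; rewrite gt_max padicnormN hb.
pose s : int := m * (l ^ k)%N - n * (l ^ j)%N.
have es : a - b = s%:~R / (l ^ (j + k))%N%:~R.
  rewrite ea eb /s intrB !intrM -!pmulrn !natrX exprD.
  by field; rewrite !expf_neq0.
have [s0|s0] := eqVneq s 0.
  by apply/eqP; rewrite -subr_eq0 es s0 mul0r.
exfalso; move: hab; rewrite es padic_abs_frac//; last first.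
  by rewrite eqz_nat -lt0n expn_gt0 l0.
rewrite /= pfactorK// -(expr0z l%:R) ltr_eXz2l ?ltr1n ?prime_gt1// => h.
have : (l ^ (j + k).+1 %| `|s|)%N by rewrite pfactor_dvdn ?absz_gt0//; lia.
move=> /dvdn_leq; rewrite absz_gt0 => /(_ s0); apply/negP; rewrite -ltnNge.
have : `|a - b| < l%:R by rewrite ltr_norml; apply/andP; split; lra.
have lp0 : 0 < (l ^ (j + k))%N%:R :> rat by rewrite ltr0n expn_gt0 l0.
rewrite es -pmulrn normrM normfV normr_nat ltr_pdivrMr// -natrM -expnS.
by rewrite -intr_norm -abszE -pmulrn ltr_nat.
Qed.

(* The n-th complete quotient alpha_n, or None if the procedure has already
   stopped before step n. *)
Fixpoint ruban_quotient (l : nat) (x : padic l) (n : nat) : option (padic l) :=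
  match n with
  | 0 => Some x
  | n'.+1 =>
    if ruban_quotient x n' is Some y then
      let r := y - ratr (padic_floor y) in
      if r == 0 then None else Some r^-1
    else None
  end.

Definition ruban_terminates (l : nat) (x : padic l) : Prop :=
  exists n y, ruban_quotient x n = Some y /\ y - ratr (padic_floor y) = 0.

(* Main.v *)
Require Import Defs.
From mathcomp Require Import all_boot all_order all_algebra.
From mathcomp Require Import boolp classical_sets functions cardinality.
From mathcomp Require Import zify ring.

Import Order.TTheory GRing.Theory Num.Theory.
Local Open Scope classical_set_scope.
Local Open Scope ring_scope.

(** Every complete quotient of a rational number is again rational, so it also
    has a sign at the real place, and the expansion is governed by comparing
    each quotient [q] with its floor [a] as rational numbers.  If [q < a], then
    [1 / (q - a)] is negative; floors being nonnegative, this next quotient is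
    again strictly below its floor, and so on: the expansion never reaches a
    zero remainder ([ruban_terminatesPn]).  Negative numbers start out in this
    situation, whence (i).

    For a nonnegative rational, a prime [l] exceeding the numerator forces
    [q <= a] ([le_padic_floor]): a positive [q - a] would be a rational whose
    numerator is divisible by too high a power of [l] for its size.  If
    moreover [l] exceeds the denominator, then equality is possible only for an
    integer, as [a] lies in Z[1/l] ([int_in_Zinv]).  So a non-integer satisfies
    [q < a] for all large [l], whence (iii).  An integer [0 <= n < l] is its own
    floor, so that the expansion stops at once, whence (ii). *)

Lemma padic_floorP {l : nat} (x : padic l) :
  prime l -> is_padic_floor x (padic_floor x).
Proof. by move=> lp; exact: (xgetPex 0 (padic_floor_exists x lp)). Qed.

Lemma padic_ratrV l (q : rat) : ratr q^-1 = (ratr q)^-1 :> padic l.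
Proof. by rewrite !padic_ratrE fmorphV. Qed.

Lemma padic_ratr_eq0 l (q : rat) : (ratr q == 0 :> padic l) = (q == 0).
Proof. by rewrite padic_ratrE fmorph_eq0. Qed.

(** The condition [q < padic_floor q] propagates from each complete quotient to
    the next, because the remainder is then negative while floors are
    nonnegative. *)
Lemma ruban_terminatesPn l (q : rat) : prime l ->
  q < padic_floor (ratr q : padic l) -> ~ ruban_terminates (ratr q : padic l).
Proof.
move=> lp qa.
have below n : exists2 p, ruban_quotient (ratr q : padic l) n = Some (ratr p) &
    p < padic_floor (ratr p : padic l).
  elim: n => [|n [p /= -> pa]]; first by exists q.
  rewrite -padic_ratrB padic_ratr_eq0 subr_eq0 lt_eqF//.
  exists (p - padic_floor (ratr p : padic l))^-1; first by rewrite padic_ratrV.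
  have [_ floor_ge0 _ _] := padic_floorP
    (ratr (p - padic_floor (ratr p : padic l))^-1) lp.
  by apply: lt_le_trans floor_ge0; rewrite invr_lt0 subr_lt0.
move=> [n [y [+ /eqP]]]; have [p -> pa] := below n => -[<-].
by rewrite -padic_ratrB padic_ratr_eq0 subr_eq0 lt_eqF.
Qed.

(** Were [a := padic_floor q] smaller than [q], the integer
    [s := numq q * l ^ k - m * denq q], where [a = m / l ^ k], would be positive
    and at most [numq q * l ^ k < l ^ k.+1]; but [q - a] has positive valuation,
    so [l ^ k.+1] divides [s]. *)
Lemma le_padic_floor l (q : rat) : prime l -> numq q < l%:Z ->
  q <= padic_floor (ratr q : padic l).
Proof.
move=> lp nl; have [[m [k ->]] a0 _] := padic_floorP (ratr q : padic l) lp.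
rewrite -padic_ratrB padicnorm_ratr => qa1; rewrite leNgt; apply/negP => aq.
have l0 : (0 < l)%N := prime_gt0 lp.
have lk0 : 0 < l%:R ^+ k :> rat by rewrite exprn_gt0// ltr0n.
have m0 : 0 <= m by move: a0; rewrite pmulr_lge0 ?invr_gt0// ler0z.
pose s : int := numq q * (l ^ k)%N - m * denq q.
pose d : int := denq q * (l ^ k)%N.
have d0 : 0 < d by rewrite mulr_gt0// ltz_nat expn_gt0 l0.
have qaE : q - m%:~R / l%:R ^+ k = s%:~R / d%:~R.
  rewrite -{1}(divq_num_den q) /s /d intrB !intrM -!pmulrn natrX.
  by field; rewrite intr_eq0 denq_neq0 lt0r_neq0.
have s0 : 0 < s.
  by move: aq; rewrite -subr_gt0 qaE pmulr_lgt0 ?invr_gt0 ltr0z.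
move: qa1; rewrite qaE padic_abs_frac ?lt0r_neq0//.
rewrite -(expr0z l%:R) ltr_eXz2l ?ltr1n ?prime_gt1//.
rewrite /d abszM lognM ?absz_gt0 ?denq_neq0 ?eqz_nat -?lt0n ?expn_gt0 ?l0//.
rewrite /= pfactorK// => vs.
have : (l ^ k.+1 %| `|s|)%N by rewrite pfactor_dvdn ?absz_gt0 ?lt0r_neq0//; lia.
move=> /dvdn_leq; rewrite absz_gt0 lt0r_neq0// => /(_ isT).
apply/negP; rewrite -ltnNge -ltz_nat gtz0_abs//.
apply: (@le_lt_trans _ _ (numq q * (l ^ k)%N)).
  by rewrite lerBlDr lerDl mulr_ge0.
by rewrite expnS PoszM ltr_pM2r// ltz_nat expn_gt0 l0.
Qed.

(** The reduced denominator of an element of Z[1/l] is a power of [l], and the only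
    such power below [l] is 1. *)
Lemma int_in_Zinv l (q : rat) : prime l -> (`|denq q| < l)%N ->
  in_Zinv l q -> q \is a Num.int.
Proof.
move=> lp dl [m [k qE]].
have lk0 : l%:R ^+ k != 0 :> rat.
  by rewrite expf_neq0// pnatr_eq0 -lt0n prime_gt0.
have e : numq q * (l ^ k)%N = m * denq q.
  apply: (@intr_inj rat); rewrite !intrM numqE -pmulrn natrX.
  by rewrite {1}qE mulrAC divfK.
have dlk : (`|denq q| %| l ^ k)%N.
  have := congr1 (fun z => `|z|%N) e; rewrite !abszM /= => e'.
  rewrite -(@Gauss_dvdr _ `|numq q|); first by rewrite e' dvdn_mull.
  by rewrite coprime_sym coprime_num_den.
have : coprime `|denq q| (l ^ k).
  apply: coprimeXr; rewrite coprime_sym prime_coprime//.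
  by apply: contraL dl => /dvdn_leq; rewrite absz_gt0 denq_neq0 -leqNgt; apply.
rewrite /coprime (gcdn_idPl dlk) => /eqP d1.
by rewrite Qint_def -absz_denq d1.
Qed.

Lemma padic_floor_nat l (n : nat) : prime l -> (n < l)%N ->
  padic_floor (ratr n%:R : padic l) = n%:R.
Proof.
move=> lp nl; apply: (padic_floor_unique lp (padic_floorP _ lp)).
split; rewrite ?ler0n ?ltr_nat//.
  by exists n%:Z, 0%N; rewrite expr0 divr1.
by rewrite -padic_ratrB padicnorm_ratr subrr padic_abs0.
Qed.

Theorem proposition3p3 (alpha : rat) :
  [/\ alpha < 0 ->
        forall l : nat, prime l -> ~ ruban_terminates (ratr alpha : padic l),
      0 <= alpha -> alpha \is a Num.int ->
        finite_set [set l : nat |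
          prime l /\ ~ ruban_terminates (ratr alpha : padic l)]
    & 0 <= alpha -> alpha \isn't a Num.int ->
        finite_set [set l : nat |
          prime l /\ ruban_terminates (ratr alpha : padic l)]].
Proof.
split=> [alpha_lt0 l lp|alpha_ge0 /intrP[z alphaE]|_ alphaN].
- apply: ruban_terminatesPn => //.
  have [_ floor_ge0 _ _] := padic_floorP (ratr alpha : padic l) lp.
  exact: lt_le_trans floor_ge0.
- move: alpha_ge0; rewrite {}alphaE ler0z; case: z => // n _.
  apply: (sub_finite_set _ (finite_II n.+1)) => l /= [lp nterm].
  rewrite ltnS leqNgt; apply/negP => nl; apply: nterm.
  by exists 0%N, (ratr n%:R); rewrite padic_floor_nat// subrr.
- apply: (sub_finite_set _ (finite_II (maxn `|numq alpha| `|denq alpha|).+1)).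
  move=> l /= [lp term]; rewrite ltnS leqNgt gtn_max; apply/negP => /andP[nl dl].
  apply: ruban_terminatesPn term => //.
  rewrite lt_neqAle le_padic_floor ?andbT//; last first.
    by apply: le_lt_trans (ler_norm _) _; rewrite -abszE ltz_nat.
  apply: contraNneq alphaN => alphaE; apply: (int_in_Zinv _ _ lp dl).
  by rewrite alphaE; have [] := padic_floorP (ratr alpha : padic l) lp.
Qed.
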